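(* Let $1<p<\infty$, let $X$ be a (real) $\mathcal{L}^p(\mu)$-space for an arbitrary measure $\mu$, and let $Y$ be a real normed space. Suppose that $f: X \rightarrow Y$ is a surjective phase-isometry. Then $f$ is phase equivalent to a linear isometry.
   Context: A mapping $f: X\to Y$ between real normed spaces is a phase-isometry if $\{\|f(x)+f(y)\|, \|f(x)-f(y)\|\}=\{\|x+y\|, \|x-y\|\}$ (equality of unordered pairs) for all $x,y\in X$. No continuity or linearity is assumed. A mapping $f:X\to Y$ is phase equivalent to a linear isometry if there exists a function $\varepsilon: X\to\{-1,1\}$ such that the map $x\mapsto \varepsilon(x)f(x)$ is a linear isometry. $\mathcal{L}^p(\mu)$ is the usual space of (classes of) real-valued $p$-integrable functions with the $L^p$-norm. *)

(* Defs.v *)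
From HB Require Import structures.
From mathcomp Require Import all_boot all_order all_algebra.
From mathcomp Require Import all_classical all_reals all_analysis.
From mathcomp Require Import measurable_realfun ess_sup_inf.

Set Implicit Arguments.
Unset Strict Implicit.
Unset Printing Implicit Defensive.

Import Order.TTheory GRing.Theory Num.Theory.
Import numFieldNormedType.Exports.

Local Open Scope classical_set_scope.
Local Open Scope ring_scope.

(* hoelder.v defines LspaceType mu p1 as the set of classes of measurable
   functions modulo equality mu-a.e. whose Lp-norm is finite, but gives it no
   algebraic structure.  Here it becomes a normedModType over R, the operations
   being those of LfunType mu p1 (functions) transported through the quotient;
   Lspace_addE, Lspace_scaleE and Lspace_normE characterize them. *)
Section Lspace_normedModType.
Context d (T : measurableType d) (R : realType).
Variables (mu : {measure set T -> \bar R}) (p : \bar R) (p1 : (1 <= p)%E).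

Local Notation Lp := (LspaceType mu p1).
Local Notation Lf := (LfunType mu p1).

Lemma ae_eq_Lnorm (f g : T -> R) :
  measurable_fun setT f -> measurable_fun setT g -> f = g %[ae mu] ->
  'N[mu]_p[EFin \o f]%E = 'N[mu]_p[EFin \o g]%E.
Proof.
move=> mf mg fg; rewrite unlock /Lnorm.
case: p p1 => [r r1|_|//].
  congr (_ `^ _)%E; apply: ae_eq_integral => //=.
  - apply/measurable_EFinP.
    apply: (@measurableT_comp _ _ _ _ _ _ (@powR R ^~ r)) => //.
    exact: measurableT_comp.
  - apply/measurable_EFinP.
    apply: (@measurableT_comp _ _ _ _ _ _ (@powR R ^~ r)) => //.
    exact: measurableT_comp.
  - by apply: filterS fg => x /= /[apply] ->.
by case: ifPn => // _; apply: eq_ess_sup; apply: filterS fg => x /= ->.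
Qed.

Lemma Lspace_measurable (u : Lp) : measurable_fun setT (u : T -> R).
Proof.
exact: (@measurable_funPT _ _ _ (measurableTypeR R)
          (repr (LebesgueSpace.sort u))).
Qed.

Lemma Lspace_mem (u : Lp) : (u : T -> R) \in Lfun mu p.
Proof.
apply/andP; split; apply/mem_set; first exact: Lspace_measurable.
exact: (@Lebesgue_finite _ _ _ _ _ p1).
Qed.

Definition Lspace_repr (u : Lp) : Lf := Lfun_Sub p1 (Lspace_mem u).

Lemma mfun_class_subproof (f : Lf) :
  isMeasurableFun d _ T (measurableTypeR R) (f : T -> R).
Proof. by split; exact: (@measurable_funPT _ _ _ _ f). Qed.

Definition mfun_class (f : Lf) : {mfun_ mu, T >-> measurableTypeR R} :=
  (\pi_({mfun_ mu, T >-> measurableTypeR R})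
    (MeasurableFun.Pack (MeasurableFun.Class (mfun_class_subproof f))))%qT.

Lemma mfun_classE (f : Lf) : (mfun_class f : T -> R) = f %[ae mu].
Proof.
have /eqmodP/asboolP := reprK (mfun_class f).
by [].
Qed.

Lemma mfun_class_finite_norm (f : Lf) : finite_norm mu p (mfun_class f : T -> R).
Proof.
rewrite /finite_norm (ae_eq_Lnorm _ _ (mfun_classE f)).
- exact: Lfunction_finite.
- exact: (@measurable_funPT _ _ _ (measurableTypeR R) (repr (mfun_class f))).
- exact: (@measurable_funPT _ _ _ _ f).
Qed.

Definition Lspace_class (f : Lf) : Lp :=
  LebesgueSpace.Pack (LebesgueSpace.Class
    (isFinLebesgue.Build _ _ _ _ _ p1 (mfun_class f) (mfun_class_finite_norm f))).

Lemma Lspace_classE (f : Lf) : (Lspace_class f : T -> R) = f %[ae mu].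
Proof. exact: mfun_classE. Qed.

Lemma Lspace_eqP (u v : Lp) : u = v <-> (u : T -> R) = v %[ae mu].
Proof.
split=> [->|uv]; first exact: ae_eq_refl.
case: u v uv => [u [[hu]]] [v [[hv]]] /= uv.
have uvE : u = v.
  rewrite -(reprK u) -(reprK v); apply/eqmodP/asboolP; exact: uv.
by case: _ / uvE hv {uv} => hv; rewrite (Prop_irrelevance hu hv).
Qed.

Lemma Lspace_reprE (u : Lp) : (Lspace_repr u : T -> R) = u.
Proof. by []. Qed.

Lemma Lspace_reprK : cancel Lspace_repr Lspace_class.
Proof. by move=> u; apply/Lspace_eqP/Lspace_classE. Qed.

Lemma Lspace_class_eq (f g : Lf) :
  f = g %[ae mu] -> Lspace_class f = Lspace_class g.
Proof.
move=> fg; apply/Lspace_eqP; apply: (ae_eq_trans (Lspace_classE f)).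
exact: (ae_eq_trans fg (ae_eq_sym (Lspace_classE g))).
Qed.

HB.instance Definition _ := gen_eqMixin Lp.
HB.instance Definition _ := gen_choiceMixin Lp.

Definition Lspace_add (u v : Lp) := Lspace_class (Lspace_repr u + Lspace_repr v).
Definition Lspace_opp (u : Lp) := Lspace_class (- Lspace_repr u).
Definition Lspace_scale (a : R) (u : Lp) := Lspace_class (a *: Lspace_repr u).
Definition Lspace_norm (u : Lp) : R := fine 'N[mu]_p[EFin \o u].

Let class_add (f g : Lf) :
  Lspace_add (Lspace_class f) (Lspace_class g) = Lspace_class (f + g).
Proof.
apply: Lspace_class_eq.
by apply: filterS2 (Lspace_classE f) (Lspace_classE g) => x fE gE _;
  congr (_ + _); [exact: fE|exact: gE].
Qed.

Let class_opp (f : Lf) : Lspace_opp (Lspace_class f) = Lspace_class (- f).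
Proof.
apply: Lspace_class_eq.
by apply: filterS (Lspace_classE f) => x fE _; congr (- _); exact: fE.
Qed.

Let class_scale a (f : Lf) :
  Lspace_scale a (Lspace_class f) = Lspace_class (a *: f).
Proof.
apply: Lspace_class_eq.
by apply: filterS (Lspace_classE f) => x fE _; congr (_ * _); exact: fE.
Qed.

Let class_norm (f : Lf) :
  Lspace_norm (Lspace_class f) = fine 'N[mu]_p[EFin \o f].
Proof.
congr fine; apply: ae_eq_Lnorm (Lspace_classE f).
  exact: Lspace_measurable.
exact: (@measurable_funPT _ _ _ _ f).
Qed.

Let LpP (P : Lp -> Prop) : (forall f, P (Lspace_class f)) -> forall u, P u.
Proof. by move=> Pf u; rewrite -(Lspace_reprK u). Qed.

Let addA : associative Lspace_add.
Proof.
by elim/LpP => f; elim/LpP => g; elim/LpP => h; rewrite !class_add addrA.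
Qed.

Let addC : commutative Lspace_add.
Proof. by elim/LpP => f; elim/LpP => g; rewrite !class_add addrC. Qed.

Let add0 : left_id (Lspace_class 0) Lspace_add.
Proof. by elim/LpP => f; rewrite class_add add0r. Qed.

Let addN : left_inverse (Lspace_class 0) Lspace_opp Lspace_add.
Proof. by elim/LpP => f; rewrite class_opp class_add addNr. Qed.

HB.instance Definition _ := GRing.isZmodule.Build Lp addA addC add0 addN.

Let addE (u v : Lp) : u + v = Lspace_add u v. Proof. by []. Qed.

Let scaleA a b u :
  Lspace_scale a (Lspace_scale b u) = Lspace_scale (a * b) u.
Proof. by elim/LpP: u => f; rewrite !class_scale scalerA. Qed.

Let scale1 : left_id 1 Lspace_scale.
Proof. by elim/LpP => f; rewrite class_scale scale1r. Qed.

Let scaleDr : right_distributive Lspace_scale +%R.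
Proof.
move=> a; elim/LpP => f; elim/LpP => g.
rewrite !addE (class_scale a f) (class_scale a g) !class_add.
by rewrite class_scale scalerDr.
Qed.

Let scaleDl u : {morph Lspace_scale^~ u : a b / a + b}.
Proof.
elim/LpP: u => f a b.
by rewrite addE !class_scale class_add -scalerDl.
Qed.

HB.instance Definition _ :=
  GRing.Zmodule_isLmodule.Build R Lp scaleA scale1 scaleDr scaleDl.

Let normD (u v : Lp) : Lspace_norm (u + v) <= Lspace_norm u + Lspace_norm v.
Proof.
elim/LpP: u => f; elim/LpP: v => g.
by rewrite addE class_add !class_norm ler_LnormD.
Qed.

Let normZ a (u : Lp) : Lspace_norm (a *: u) = `|a| * Lspace_norm u.
Proof.
elim/LpP: u => f; rewrite [X in Lspace_norm X]class_scale !class_norm.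
by rewrite LnormZ -finite_norm_fine.
Qed.

Let norm0_eq0 (u : Lp) : Lspace_norm u = 0 -> u = 0.
Proof.
elim/LpP: u => f; rewrite class_norm => /fine_Lnormr_eq0 f0.
exact: Lspace_class_eq.
Qed.

HB.instance Definition _ := Lmodule_isNormed.Build R Lp normD normZ norm0_eq0.

Lemma Lspace_addE (u v : Lp) : (u + v : Lp) = (fun x => u x + v x) %[ae mu].
Proof. exact: Lspace_classE. Qed.

Lemma Lspace_scaleE a (u : Lp) : (a *: u : Lp) = (fun x => a * u x) %[ae mu].
Proof. exact: Lspace_classE. Qed.

Lemma Lspace_normE (u : Lp) : `|u|%:E = 'N[mu]_p[EFin \o u]%E.
Proof. exact: (finite_norm_fine (Lspace_repr u)). Qed.

End Lspace_normedModType.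

Section phase_isometry.
Context (R : realType) (X Y : normedModType R).

(* Two-element multisets coincide iff the underlying sets do, so equality of
   sets is equality of unordered pairs here. *)
Definition phase_isometry (f : X -> Y) :=
  forall x y : X, [set `|f x + f y|; `|f x - f y|] = [set `|x + y|; `|x - y|].

Definition linear_isometry (g : X -> Y) :=
  linear g /\ forall x y : X, `|g x - g y| = `|x - y|.

Definition phase_equivalent_to_linear_isometry (f : X -> Y) :=
  exists2 eps : X -> R, range eps `<=` [set -1; 1] &
    linear_isometry (fun x => eps x *: f x).

End phase_isometry.

(* Main.v *)
(* [L^p] with [1 < p] is strictly convex and smooth, and the conclusion holds for
   every such space [X].  Strict convexity makes [f] homogeneous up to sign.  The
   derivative of the norm at [x] is a limit of [`|t x + z| - t `|x|] as [t] tends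
   to infinity, so [f] transports it: [Y] is smooth at [f x] and the norm
   derivatives satisfy [|D_(f x) (f z)| = |D_x z|], both sides being linear in the
   direction.  If [f z = f x + f y], then every [D_u] vanishing at [x] and [y]
   vanishes at [z]; taking for [u] the difference of [z] and its best approximation
   in the plane of [x] and [y] shows that [z] lies in that plane, and functionals
   killing only one of [x], [y] show that [z] is [+-x+-y].  Hence [f (x + y)] is
   [+-f x+-f y], and signs can be chosen coherently by comparing with a fixed
   vector. *)
Require Import Defs.
From HB Require Import structures.
From mathcomp Require Import all_boot all_order all_algebra.
From mathcomp Require Import all_classical all_reals all_analysis.
From mathcomp Require Import measurable_realfun ring lra.

Set Implicit Arguments.
Unset Strict Implicit.
Unset Printing Implicit Defensive.

Import Order.TTheory GRing.Theory Num.Theory.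
Import numFieldNormedType.Exports.

Local Open Scope classical_set_scope.
Local Open Scope ring_scope.

(** * Equality up to sign *)

Definition pm (V : zmodType) (u v : V) := u = v \/ u = - v.

Section pm_theory.
Context (V : zmodType).
Implicit Types u v w : V.

Lemma pm_refl u : pm u u. Proof. by left. Qed.

Lemma pm_sym u v : pm u v -> pm v u.
Proof. by case=> ->; [left|right; rewrite opprK]. Qed.

Lemma pm_trans v u w : pm u v -> pm v w -> pm u w.
Proof.
by case=> -> [->|->]; rewrite ?opprK; [left|right|right|left].
Qed.

Lemma pmN u : pm (- u) u. Proof. by right. Qed.

Lemma pm0 u : pm u 0 -> u = 0.
Proof. by case=> ->; rewrite ?oppr0. Qed.

End pm_theory.

Lemma double_eq0 (R : numFieldType) (V : lmodType R) (v : V) :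
  v + v = 0 -> v = 0.
Proof.
by move=> /eqP; rewrite -mulr2n -scaler_nat scaler_eq0 pnatr_eq0 => /eqP.
Qed.

(** * Coherent signs for a map additive and homogeneous up to sign *)

Section phase_choice.
Context (R : numFieldType) (V W : lmodType R) (f : V -> W).
Hypothesis fZ : forall t x, pm (f (t *: x)) (t *: f x).
Hypothesis f_inj : forall x y, pm (f x) (f y) -> pm x y.
Hypothesis fD : forall x y, pm (f (x + y)) (f x + f y) \/ pm (f (x + y)) (f x - f y).

Let f0 : f 0 = 0.
Proof. by have := fZ 0 0; rewrite !scale0r => /pm0. Qed.

Let fN x : pm (f (- x)) (f x).
Proof. by rewrite -scaleN1r; apply: pm_trans (fZ _ _) _; rewrite scaleN1r; right. Qed.

Let f_eq0 x : f x = 0 -> x = 0.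
Proof. by move=> fx0; apply/pm0/f_inj; rewrite fx0 f0; left. Qed.

Let oppW (w : W) : w = - w -> w = 0.
Proof. by move=> e; apply: double_eq0; rewrite {1}e addNr. Qed.

(* The phase of [f x] is read off [f (x0 + x)]. *)
Variable x0 : V.
Hypothesis x0_neq0 : x0 <> 0.

Let phase_ex x : exists w, pm w (f x) /\ pm (f (x0 + x)) (f x0 + w).
Proof.
by case: (fD x0 x) => h; [exists (f x)|exists (- f x)]; split => //; [left|right].
Qed.

Definition phase_fix x := projT1 (cid (phase_ex x)).
Local Notation g := phase_fix.

Let g_pm x : pm (g x) (f x).
Proof. by rewrite /g; case: cid => w []. Qed.

Let g_x0 x : pm (f (x0 + x)) (f x0 + g x).
Proof. by rewrite /g; case: cid => w []. Qed.

Let F := f x0.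

Let F_neq0 : F <> 0.
Proof. by move/f_eq0. Qed.

Let gf x y : pm (f y) (f x) -> pm (f y) (g x).
Proof. by move/pm_trans; apply; apply: pm_sym. Qed.

Let g_inj x y : pm (g x) (g y) -> pm x y.
Proof.
move=> h; apply: f_inj; apply: pm_trans (gf (pm_refl _)) _.
exact: pm_trans h (g_pm _).
Qed.

Let pmFN u : pm (F + u) (F - u) -> u = 0.
Proof.
case=> [/addrI/oppW //|]; rewrite opprD opprK => /addIr/oppW.
by move/F_neq0.
Qed.

Let g0 : g 0 = 0.
Proof. by have := g_pm 0; rewrite f0 => /pm0. Qed.

(** Otherwise [f (x0 - x)] and [f (x0 + x)] agree up to sign, and injectivity gives [x = 0] or
    [x0 = 0]. *)
Let gN x : g (- x) = - g x.
Proof.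
have: pm (g (- x)) (g x).
  exact: pm_trans (g_pm _) (pm_trans (fN _) (pm_sym (g_pm _))).
case=> // e.
have /f_inj : pm (f (x0 - x)) (f (x0 + x)).
  by apply: pm_trans (g_x0 _) _; rewrite e; apply/pm_sym/g_x0.
case=> [/addrI h|].
  have -> : x = 0 by apply: double_eq0; rewrite -{1}h addNr.
  by rewrite oppr0 g0 oppr0.
rewrite opprD => /addIr h; case: x0_neq0.
by apply: double_eq0; rewrite {1}h addNr.
Qed.

Let gNx0 : g (- x0) = - F.
Proof.
have := g_x0 (- x0); rewrite subrr f0 => /pm_sym/pm0 /eqP.
by rewrite addrC addr_eq0 => /eqP.
Qed.

Let gx0 : g x0 = F.
Proof. by have := gN x0; rewrite gNx0 => /oppr_inj ->. Qed.

(** With the wrong sign, [f (x0 + (x0 + x))] is [f x] up to sign, so injectivity leaves only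
    [x = - x0], where both sides vanish. *)
Let gDx0 x : g (x0 + x) = F + g x.
Proof.
case: (pm_trans (g_pm _) (g_x0 x)) => // e.
have : pm (f (x0 + (x0 + x))) (f x).
  apply: pm_trans (g_x0 _) _; rewrite e opprD addrA addrN add0r.
  exact: pm_trans (pmN _) (g_pm _).
move=> /f_inj; rewrite addrA; case.
  by rewrite -[RHS]add0r => /addIr/double_eq0.
move=> /eqP; rewrite -addr_eq0 -[X in X == 0]addrA addrACA => /eqP/double_eq0/eqP.
by rewrite e addrC addr_eq0 => /eqP ->; rewrite gNx0 addrN oppr0.
Qed.

Let pmD (c a a' b b' : W) : pm a a' -> pm b b' ->
  pm c (a + b) \/ pm c (a - b) -> pm c (a' + b') \/ pm c (a' - b').
Proof.
move=> [->|->] [->|->]; rewrite ?opprK //; last 2 first.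
- case=> h; [right|left]; apply: pm_trans h _; right.
    by rewrite opprB addrC.
  by rewrite opprD.
- case=> h; [left|right]; apply: pm_trans h _; right.
    by rewrite opprD.
  by rewrite opprB addrC.
- by case; [right|left].
Qed.

Let f_x0D x y : pm (f (x0 + (x + y))) (F + (g x + g y)) \/
                pm (f (x0 + (x + y))) (F + (g x - g y)).
Proof.
rewrite !addrA.
apply: (pmD (g_x0 x) (pm_sym (g_pm y))); exact: fD.
Qed.

(** Here [f (x0 + (x + y))] is [F + (g x - g y)] up to sign. Matching this with [f_x0D y x] leaves
    [g y = 0], [x = - x0] or [x + y = 0]. *)
Let gDB x y : g (x + y) = g x - g y -> g (x + y) = g x + g y.
Proof.
move=> e; have h : pm (f (x0 + (x + y))) (F + (g x - g y)).
  by rewrite -e; apply: g_x0.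
have [] := f_x0D y x; rewrite [y + x]addrC => /(pm_trans (pm_sym h)).
- rewrite [g y + g x]addrC !addrA => -[/addrI/esym/oppW y0|].
    by rewrite e y0 subr0 addr0.
  rewrite opprD => /addIr/oppW/eqP; rewrite addrC addr_eq0 => /eqP gx.
  have /g_inj[xE|xE] : pm (g x) (g x0) by rewrite gx0; right.
    by move: gx; rewrite xE gx0 => /oppW/F_neq0.
  have := gDx0 (x + y); rewrite xE addNKr => ->.
  by rewrite gNx0 addKr.
- rewrite -[g y - g x]opprB => /pmFN/eqP; rewrite -e => /eqP gxy.
  have : x + y = 0.
    by apply: f_eq0; apply: pm0; rewrite -gxy; apply/pm_sym/g_pm.
  by move/eqP; rewrite addrC addr_eq0 => /eqP ->; rewrite gN addrN addNr g0.
Qed.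

(** Unless [g x + g y = 0], the two orders of [f_x0D] make [F + (g x - g y)] and [F - (g x - g y)]
    equal up to sign, so [g x = g y] and [x] is [y] or [- y]. In the case [x = y], only [x = x0]
    remains. *)
Let gDN x y : g (x + y) = - (g x + g y) -> g (x + y) = g x + g y.
Proof.
move=> e; have h : pm (f (x0 + (x + y))) (F - (g x + g y)).
  by rewrite -e; apply: g_x0.
have [] := f_x0D x y => /(pm_trans (pm_sym h)).
  by move/pm_sym/pmFN => S0; rewrite e S0 oppr0.
have [] := f_x0D y x; rewrite [y + x]addrC => /(pm_trans (pm_sym h)).
  by rewrite [g y + _]addrC => /pm_sym/pmFN S0; rewrite e S0 oppr0.
move=> /pm_sym h1 /(pm_trans h1); rewrite -[g y - g x]opprB => h2.
have /pmFN/eqP : pm (F + (g x - g y)) (F - (g x - g y)) by exact: pm_sym.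
rewrite subr_eq0 => /eqP gxy.
have /g_inj[xy|xy] : pm (g x) (g y) by left.
  subst y; have := pm_sym h1; rewrite addrN addr0.
  case => [/eqP|].
    rewrite -subr_eq0 addrC addKr oppr_eq0 => /eqP S0.
    by rewrite e S0 oppr0.
  move/(congr1 (+%R F)); rewrite addrN addrA => /eqP; rewrite subr_eq0 => /eqP h3.
  have gxF : g x = F.
    apply/eqP; rewrite -subr_eq0; apply/eqP/(@double_eq0 R).
    by rewrite addrACA -opprD -h3 subrr.
  have /g_inj[xE|xE] : pm (g x) (g x0) by left; rewrite gx0.
    by rewrite xE gDx0 gx0.
  by move: gxF; rewrite xE gNx0 => /esym/oppW/F_neq0.
by rewrite xy addNr g0 gN addNr.
Qed.

Lemma phase_fixD x y : g (x + y) = g x + g y.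
Proof.
have : pm (g (x + y)) (g x + g y) \/ pm (g (x + y)) (g x - g y).
  apply: (pmD (pm_sym (g_pm x)) (pm_sym (g_pm y))).
  case: (fD x y) => h; [left|right]; exact: pm_trans (g_pm _) h.
case=> -[] //; [exact: gDN|exact: gDB|].
rewrite opprB [x + y]addrC [g x + g y]addrC; exact: gDB.
Qed.

Lemma phase_fixZ t x : g (t *: x) = t *: g x.
Proof.
have gZ s : pm (g (s *: x)) (s *: g x).
  apply: pm_trans (g_pm _) (pm_trans (fZ _ _) _).
  by case: (g_pm x) => ->; [left|right; rewrite scalerN opprK].
case: (gZ t) => // e.
(* By additivity the value at [(t + 1) x] is [- t g x + g x]; it is [(t + 1) g x] up to sign only if
   [t g x = 0], where both signs agree. *)
have := gZ (t + 1); rewrite !scalerDl scale1r phase_fixD e scale1r.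
case => [/addIr //|]; rewrite opprD => /addrI/oppW ->.
by rewrite scaler0 oppr0.
Qed.

Lemma phase_fix_pm x : pm (g x) (f x).
Proof. exact: g_pm. Qed.

End phase_choice.

(** * One-sided derivatives of the norm *)

Section support_functional.
Context (R : realType) (V : normedModType R).
Implicit Types (x z w : V) (t : R).

(* Limit of the nonincreasing function [t |-> `|t *: x + z| - t * `|x|] at
   infinity, i.e. the right derivative of the norm at [x] along [z]. *)
Definition norm_dir x z : R :=
  inf [set `|t *: x + z| - t * `|x| | t in [set t | 0 < t]].

(** Gateaux differentiability of the norm, rescaled: the one-sided derivatives along [z] and [- z]
    are opposite. One [t] suffices, the quotients being nonincreasing. *)
Definition smooth_at x := forall z (e : R), 0 < e ->
  exists2 t, 0 < t & `|t *: x + z| + `|t *: x - z| < 2 * (t * `|x|) + e.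

Let quot_ge x z t : 0 < t -> - `|z| <= `|t *: x + z| - t * `|x|.
Proof.
move=> t0; have := ler_normB (t *: x + z) z.
by rewrite addrK normrZ (gtr0_norm t0); lra.
Qed.

Let quot_nonempty x z :
  [set `|t *: x + z| - t * `|x| | t in [set t : R | 0 < t]] !=set0.
Proof. by eexists; exists 1 => //=. Qed.

Lemma norm_dir_le x z t : 0 < t -> norm_dir x z <= `|t *: x + z| - t * `|x|.
Proof.
move=> t0; apply: ge_inf; last by exists t.
by exists (- `|z|) => _ [s /= s0 <-]; apply: quot_ge.
Qed.

Lemma norm_dir_ge x z m :
  (forall t, 0 < t -> m <= `|t *: x + z| - t * `|x|) -> m <= norm_dir x z.
Proof. by move=> h; apply: lb_le_inf => // _ [s /= s0 <-]; apply: h. Qed.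

(** The triangle inequality at parameter [s + t] lets the two infima be taken independently. *)
Lemma norm_dirD_le x z w : norm_dir x (z + w) <= norm_dir x z + norm_dir x w.
Proof.
rewrite -lerBlDr; apply: norm_dir_ge => s s0; rewrite lerBlDr -lerBlDl.
apply: norm_dir_ge => t t0.
have := norm_dir_le x (z + w) (addr_gt0 s0 t0).
have := ler_normD (s *: x + z) (t *: x + w).
by rewrite addrACA -scalerDl; lra.
Qed.

Lemma norm_dir0 x : norm_dir x 0 = 0.
Proof.
apply/le_anti/andP; split.
  by apply: le_trans (norm_dir_le x 0 ltr01) _; rewrite scale1r mul1r addr0 subrr.
by apply: norm_dir_ge => t t0; rewrite addr0 normrZ gtr0_norm// subrr.
Qed.

Lemma norm_dirxx x : norm_dir x x = `|x|.
Proof.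
have E t : 0 < t -> `|t *: x + x| - t * `|x| = `|x|.
  move=> t0; have -> : t *: x + x = (t + 1) *: x by rewrite scalerDl scale1r.
  by rewrite normrZ gtr0_norm; lra.
apply/le_anti/andP; split.
  by apply: le_trans (norm_dir_le x x ltr01) _; rewrite E.
by apply: norm_dir_ge => t t0; rewrite E.
Qed.

Let norm_dirZ_ge x z t : 0 < t -> t * norm_dir x z <= norm_dir x (t *: z).
Proof.
move=> t0; apply: norm_dir_ge => s s0.
have := norm_dir_le x z (divr_gt0 s0 t0).
rewrite -(ler_pM2l t0) => /le_trans; apply.
rewrite mulrBr mulrA -[X in X * `|_|](gtr0_norm t0) -normrZ scalerDr scalerA.
by rewrite [t * (s / t)]mulrC divfK ?gt_eqF.
Qed.

Let norm_dirZ_gt0 x z t : 0 < t -> norm_dir x (t *: z) = t * norm_dir x z.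
Proof.
move=> t0; apply/le_anti; rewrite norm_dirZ_ge// andbT.
have ti0 : 0 < t^-1 by rewrite invr_gt0.
have := norm_dirZ_ge x (t *: z) ti0.
rewrite scalerA mulVf ?gt_eqF// scale1r.
by rewrite -(ler_pM2l t0) mulrA divff ?gt_eqF// mul1r.
Qed.

Section smooth.
Variable x : V.
Hypothesis x_smooth : smooth_at x.

Lemma norm_dirN z : norm_dir x (- z) = - norm_dir x z.
Proof.
apply/le_anti/andP; split; last first.
  by have := norm_dirD_le x z (- z); rewrite addrN norm_dir0; lra.
apply/ler_addgt0Pr => e /(x_smooth z)[t t0 h].
have := norm_dir_le x z t0; have := norm_dir_le x (- z) t0; lra.
Qed.

Lemma norm_dirD z w : norm_dir x (z + w) = norm_dir x z + norm_dir x w.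
Proof.
apply/le_anti; rewrite norm_dirD_le/=.
by have := norm_dirD_le x (- z) (- w); rewrite -opprD !norm_dirN; lra.
Qed.

Lemma norm_dirZ t z : norm_dir x (t *: z) = t * norm_dir x z.
Proof.
case: (ltgtP t 0) => [t0|t0|->]; last by rewrite scale0r mul0r norm_dir0.
  have := @norm_dirZ_gt0 x z (- t); rewrite oppr_gt0 scaleNr norm_dirN => /(_ t0).
  by lra.
exact: norm_dirZ_gt0.
Qed.

End smooth.
End support_functional.

(** * Best approximation in lines and planes *)

Section best_approximation.
Context (R : realType) (V : normedModType R).
Implicit Types (S : set V) (x y z : V).

Definition subspace S := S 0 /\ forall a u v, S u -> S v -> S (a *: u + v).

Definition proximinal S :=
  forall z, exists2 v, S v & forall w, S w -> `|z - v| <= `|z - w|.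

Definition add_line S y : set V := [set v | exists t : R, S (v - t *: y)].

Lemma subspace0 : subspace [set 0].
Proof. by split=> // a u v /= -> ->; rewrite scaler0 addr0. Qed.

Lemma proximinal0 : proximinal [set 0].
Proof. by move=> z; exists 0 => // w /= ->. Qed.

Lemma subspaceZ S a u : subspace S -> S u -> S (a *: u).
Proof. by move=> [S0 SD] Su; rewrite -[_ *: _]addr0; apply: SD. Qed.

Lemma subspace_add_line S y : subspace S -> subspace (add_line S y).
Proof.
move=> [S0 SD]; split; first by exists 0; rewrite scale0r subrr.
move=> a u v [s Su] [t Sv]; exists (a * s + t).
have := SD a _ _ Su Sv.
by rewrite scalerBr scalerDl opprD -scalerA addrACA.
Qed.

Lemma sub_add_line S y u : S u -> add_line S y u.
Proof. by move=> Su; exists 0; rewrite scale0r subr0. Qed.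

Lemma mem_add_line S y : S 0 -> add_line S y y.
Proof. by move=> S0; exists 1; rewrite scale1r subrr. Qed.

Lemma coercive_min (F : R -> R) (M : R) : continuous F ->
  (forall t, M < `|t| -> F 0 <= F t) -> exists c, forall t, F c <= F t.
Proof.
(* The maximum keeps 0 in [[- N, N]] even when [M] is negative. *)
move=> cF FM; pose N := Num.max M 0.
have N0 : 0 <= N by rewrite le_max lexx orbT.
have NN : - N <= N by lra.
have [c _ cmin] := EVT_min NN (continuous_subspaceT cF).
exists c => t; have [tN|Nt] := leP `|t| N.
  by apply: cmin; rewrite in_itv/= -ler_norml.
apply: (le_trans (cmin 0 _)); first by rewrite in_itv/= oppr_le0 N0.
by apply: FM; apply: le_lt_trans Nt; rewrite le_max lexx.
Qed.

Lemma lipschitz_continuous (F : R -> R) (k : R) :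
  (forall s t, F t <= F s + `|t - s| * k) -> continuous F.
Proof.
move=> Fk s; apply/cvgrPdist_le => e e0.
pose k' := Num.max k 1.
have k0 : 0 < k' by rewrite lt_max ltr01 orbT.
near=> t.
have h : `|t - s| * k' <= e.
  rewrite -ler_pdivlMr// distrC; near: t.
  by apply: cvgr_dist_le; [exact: cvg_id|exact: divr_gt0].
have kk' (r : R) : `|r| * k <= `|r| * k' by apply: ler_wpM2l => //; rewrite le_max lexx.
have := Fk s t; have := Fk t s; rewrite (distrC s t).
have := kk' (t - s); rewrite ler_norml; lra.
Unshelve. all: by end_near. Qed.

(** For [y] outside [S], the distance from [z - t y] to [S] is Lipschitz and coercive in [t]. At a
    minimum [c], adding [c y] to the best approximation of [z - c y] gives a nearest point. *)
Lemma proximinal_add_line S y :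
  subspace S -> proximinal S -> proximinal (add_line S y).
Proof.
move=> sS pS z.
have [Sy|nSy] := pselect (S y).
  have [v Sv vmin] := pS z; exists v; first exact: sub_add_line.
  move=> w [t Sw]; apply: vmin.
  by rewrite -(subrK (t *: y) w) addrC; apply: (sS.2) Sy Sw.
have [v0 Sv0 v0min] := pS y.
pose d := `|y - v0|.
have d0 : 0 < d.
  by rewrite normr_gt0 subr_eq0; apply/eqP => yv; apply: nSy; rewrite yv.
have /choice [P PP] (t : R) : exists v, S v /\
    forall w, S w -> `|z - t *: y - v| <= `|z - t *: y - w|.
  by have [v] := pS (z - t *: y); exists v.
pose F t := `|z - t *: y - P t|.
have cF : continuous F.
  apply: (@lipschitz_continuous _ `|y|) => s t.
  apply: le_trans ((PP t).2 _ (PP s).1) _.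
  rewrite -normrZ -[`|(t - s) *: y|]normrN.
  apply: le_trans (ler_normD _ _); rewrite le_eqVlt; apply/orP; left; apply/eqP.
  congr `|_|; rewrite scalerBl opprB [RHS]addrA.
  by rewrite [_ - P s + s *: y]addrAC subrK addrAC.
have lowF t : `|t| * d <= F t + `|z|.
  have [->|t0] := eqVneq t 0; first by rewrite normr0 mul0r /F addr_ge0.
  (* This vector competes with [v0] in approximating [y]; scaling by [t] gives the growth bound. *)
  have Sv : S ((- t^-1) *: P t) by apply: subspaceZ => //; exact: (PP t).1.
  have := v0min _ Sv; rewrite -/d scaleNr opprK => /(ler_wpM2l (normr_ge0 t)).
  move=> /le_trans; apply; rewrite -normrZ scalerDr scalerA divff// scale1r.
  have -> : t *: y + P t = z - (z - t *: y - P t).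
    by rewrite -addrA -opprD opprB [RHS]addrC subrK.
  by rewrite [F t + _]addrC; apply: ler_normB.
have F0 : F 0 <= `|z|.
  by rewrite /F; have := (PP 0).2 _ sS.1; rewrite scale0r !subr0.
have [c cmin] : exists c, forall t, F c <= F t.
  (* Beyond this radius [F t >= |t| d - |z| > |z| >= F 0]. *)
  apply: (@coercive_min _ (2 * `|z| / d)) => // t.
  by rewrite ltr_pdivrMr// => ?; have := lowF t; lra.
exists (P c + c *: y); first by exists c; rewrite addrK; apply: (PP c).1.
move=> w [t Sw].
have -> : z - (P c + c *: y) = z - c *: y - P c by rewrite opprD addrA addrAC.
apply: le_trans (cmin t) _; apply: le_trans ((PP t).2 _ Sw) _.
by rewrite opprB addrA subrK.
Qed.

(** Take the residual [u = z - v]. Minimality makes [norm_dir u] nonnegative on [S], linearity makes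
    it zero there, so its value at [z] is its value at [u], namely [|u|]. *)
Lemma best_approx_norm_dir S z : subspace S -> proximinal S -> ~ S z ->
    (forall u : V, u <> 0 -> smooth_at u) ->
  exists u : V, [/\ smooth_at u, forall w, S w -> norm_dir u w = 0 &
    norm_dir u z <> 0].
Proof.
move=> sS pS nSz smoothV; have [v Sv vmin] := pS z; pose u := z - v.
have u0 : u <> 0 by move/eqP; rewrite subr_eq0 => /eqP zv; apply: nSz; rewrite zv.
have dir_ge0 w : S w -> 0 <= norm_dir u w.
  move=> Sw; apply: norm_dir_ge => t t0; rewrite subr_ge0.
  have -> : t *: u + w = t *: (z - (v - t^-1 *: w)).
    rewrite opprB addrCA [RHS]scalerDr scalerA divff ?gt_eqF// scale1r; exact: addrC.
  rewrite normrZ gtr0_norm// ler_pM2l//; apply: vmin.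
  by rewrite addrC -scaleNr; apply: sS.2.
have su := smoothV _ u0.
have dir0 w : S w -> norm_dir u w = 0.
  move=> Sw; apply/le_anti; rewrite dir_ge0// andbT -oppr_ge0 -norm_dirN//.
  by apply: dir_ge0; rewrite -scaleN1r; apply: subspaceZ.
exists u; split => //; have -> : z = u + v by rewrite subrK.
by rewrite norm_dirD// (dir0 v)// addr0 norm_dirxx => /normr0_eq0.
Qed.

End best_approximation.

(** Vectors with equality in the triangle inequality lie on a common ray; written without division,
    this also covers zero vectors. *)
Definition strictly_convex (R : realType) (V : normedModType R) :=
  forall x y : V, `|x + y| = `|x| + `|y| -> `|x| *: y = `|y| *: x.

Lemma set2_eq (T : Type) (a b c d : T) : [set a; b] = [set c; d] ->
  (a = c /\ b = d) \/ (a = d /\ b = c).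
Proof.
move=> e.
have [ac|ad] : [set c; d] a by rewrite -e; left.
- have [bc|] : [set c; d] b by rewrite -e; right.
    have [|] : [set a; b] d by rewrite e; right.
      by move=> da; left; rewrite da bc ac.
    by left.
  by left.
- have [|bd] : [set c; d] b by rewrite -e; right.
    by right.
  have [|] : [set a; b] c by rewrite e; left.
    by move=> ca; right; rewrite bd ca ad.
  by right.
Qed.

(** * Phase-isometries of smooth strictly convex spaces *)

Section phase_isometry_theory.
Context (R : realType) (X Y : normedModType R) (f : X -> Y).
Hypothesis f_surj : forall y, exists x, f x = y.
Hypothesis f_phase : phase_isometry f.
Hypothesis X_convex : strictly_convex X.
Hypothesis X_smooth : forall x : X, x <> 0 -> smooth_at x.

Let f_pair x y :
  (`|f x + f y| = `|x + y| /\ `|f x - f y| = `|x - y|) \/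
  (`|f x + f y| = `|x - y| /\ `|f x - f y| = `|x + y|).
Proof. exact/set2_eq/f_phase. Qed.

Let f_norm x : `|f x| = `|x|.
Proof.
have E (V : normedModType R) (v : V) : `|v + v| = 2 * `|v|.
  by rewrite -mulr2n normrMn mulr_natl.
by have := f_pair x x; rewrite !subrr !normr0 !E; lra.
Qed.

Let f_inj x y : pm (f x) (f y) -> pm x y.
Proof.
have [[h1 h2]|[h1 h2]] := f_pair x y; case=> e.
- by left; apply/eqP; rewrite -subr_eq0 -normr_eq0 -h2 e subrr normr0.
- by right; apply/eqP; rewrite -addr_eq0 -normr_eq0 -h1 e addNr normr0.
- by right; apply/eqP; rewrite -addr_eq0 -normr_eq0 -h2 e subrr normr0.
- by left; apply/eqP; rewrite -subr_eq0 -normr_eq0 -h1 e addNr normr0.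
Qed.

Let f_pm x y : pm x y -> pm (f x) (f y).
Proof.
case=> ->; first exact: pm_refl.
have [[h _]|[_ h]] := f_pair (- y) y; move: h; rewrite addNr normr0 => /normr0_eq0 h.
- by right; apply/eqP; rewrite -addr_eq0 h.
- by left; apply/eqP; rewrite -subr_eq0 h.
Qed.

(** Let [z] be a preimage of [t f x]. One of [|1 + t|], [|1 - t|] is [1 + |t|], so one of [|x + z|],
    [|x - z|] is [|x| + |z|], and strict convexity gives [z = |t| x] up to sign. *)
Let f_scale t x : pm (f (t *: x)) (t *: f x).
Proof.
have [z fz] := f_surj (t *: f x).
have nz : `|z| = `|t| * `|x| by rewrite -f_norm fz normrZ f_norm.
rewrite -fz; apply: f_pm; apply: pm_sym.
have [x0|x0] := eqVneq x 0.
  by left; rewrite x0 scaler0; apply: normr0_eq0; rewrite nz x0 normr0 mulr0.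
have pmt : pm (`|t| *: x) (t *: x).
  by case: (ger0P t) => _; [left|right; rewrite scaleNr].
apply: pm_trans pmt.
have dir w : `|w| = `|z| -> `|x + w| = `|x| + `|z| -> w = `|t| *: x.
  move=> wz; rewrite -wz => /X_convex; rewrite wz nz mulrC -scalerA.
  by apply: scalerI; rewrite normr_eq0.
suff [/(dir _ erefl) ->|/dir zE] : `|x + z| = `|x| + `|z| \/ `|x - z| = `|x| + `|z|.
- by left.
- by right; rewrite -zE ?normrN// opprK.
have e1 : `|f x + f z| = `|1 + t| * `|x|.
  by rewrite fz -[X in X + _]scale1r -scalerDl normrZ f_norm.
have e2 : `|f x - f z| = `|1 - t| * `|x|.
  by rewrite fz -[X in X - _]scale1r -scalerBl normrZ f_norm.
have : `|1 + t| = 1 + `|t| \/ `|1 - t| = 1 + `|t|.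
  case: (ger0P t) => t0; [left|right]; rewrite ger0_norm //; lra.
have [[h1 h2]|[h1 h2]] := f_pair x z; rewrite -h1 -h2 e1 e2 nz => -[->|->];
  by rewrite mulrDl mul1r; auto.
Qed.

Let f_pairZ t x z :
  (`|t *: f x + f z| = `|t *: x + z| /\ `|t *: f x - f z| = `|t *: x - z|) \/
  (`|t *: f x + f z| = `|t *: x - z| /\ `|t *: f x - f z| = `|t *: x + z|).
Proof.
have := f_pair (t *: x) z; case: (f_scale t x) => -> //.
rewrite -opprD normrN addrC -normrN opprB.
by case=> -[-> ->]; auto.
Qed.

Let f_smooth x : smooth_at x -> smooth_at (f x).
Proof.
move=> sx y e e0; have [z <-] := f_surj y.
have [t t0 h] := sx z e e0; exists t => //; rewrite f_norm.
have := f_pairZ t x z; lra.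
Qed.

(** The bounds [lo] and [lo'] treat [z] and [- z] alike, so they survive an exchange within the
    unordered pair; infima then give both inequalities. *)
Let f_norm_dir x z : smooth_at x ->
  `|norm_dir (f x) (f z)| = `|norm_dir x z|.
Proof.
move=> sx; have sfx := f_smooth sx.
have norm_lb (a : R) : - `|a| <= a /\ - `|a| <= - a.
  by have := ler_norm a; have := ler_norm (- a); rewrite normrN; lra.
have lo t : 0 < t -> - `|norm_dir x z| <= `|t *: x + z| - t * `|x| /\
                     - `|norm_dir x z| <= `|t *: x - z| - t * `|x|.
  move=> t0; have := norm_dir_le x z t0; have := norm_dir_le x (- z) t0.
  by rewrite norm_dirN//; have := norm_lb (norm_dir x z); lra.
have lo' t : 0 < t ->
    - `|norm_dir (f x) (f z)| <= `|t *: f x + f z| - t * `|x| /\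
    - `|norm_dir (f x) (f z)| <= `|t *: f x - f z| - t * `|x|.
  move=> t0; have := norm_dir_le (f x) (f z) t0.
  have := norm_dir_le (f x) (- f z) t0.
  by rewrite norm_dirN// !f_norm; have := norm_lb (norm_dir (f x) (f z)); lra.
apply/le_anti/andP; split; rewrite ler_norml; apply/andP; split.
- apply: norm_dir_ge => t t0; have := lo t t0; have := f_pairZ t x z.
  by rewrite f_norm; lra.
- rewrite -lerN2 -norm_dirN//.
  apply: norm_dir_ge => t t0; have := lo t t0; have := f_pairZ t x z.
  by rewrite f_norm; lra.
- apply: norm_dir_ge => t t0; have := lo' t t0; have := f_pairZ t x z; lra.
- rewrite -lerN2 -norm_dirN//.
  apply: norm_dir_ge => t t0; have := lo' t t0; have := f_pairZ t x z; lra.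
Qed.

Let line (y : X) := add_line [set 0] y.
Let plane (x y : X) := add_line (line x) y.

Let sline y : subspace (line y).
Proof. exact/subspace_add_line/subspace0. Qed.

Let pline y : proximinal (line y).
Proof. by apply/proximinal_add_line/proximinal0; exact: subspace0. Qed.

Let lineP (x y : X) : line y x -> exists t, x = t *: y.
Proof. by move=> [t /= /subr0_eq ->]; exists t. Qed.

(** Choose [u] with [norm_dir u] zero at [y] but not at [x]. Then [|norm_dir u z|] is
    [|a| |norm_dir u x|] by linearity, and [|norm_dir u x|] by transport through [f]. *)
Let add_coef x y z a b : f z = f x + f y -> z = a *: x + b *: y ->
  ~ line y x -> `|a| = 1.
Proof.
move=> fz zE nx.
have [u [su u0 ux]] := best_approx_norm_dir (@sline y) (@pline y) nx X_smooth.
have sfu := f_smooth su.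
have uy : norm_dir u y = 0 by apply: u0; exact: mem_add_line.
have /normr0_eq0 fy0 : `|norm_dir (f u) (f y)| = 0.
  by rewrite f_norm_dir// uy normr0.
have := f_norm_dir z su; rewrite fz norm_dirD// fy0 addr0 f_norm_dir//.
rewrite zE norm_dirD// !norm_dirZ// uy mulr0 addr0 normrM.
move=> /esym; rewrite -[RHS]mul1r; apply: mulIf.
by rewrite normr_eq0; apply/eqP.
Qed.

Let f_addE x y : pm (f (x + y)) (f x + f y) \/ pm (f (x - y)) (f x + f y).
Proof.
(* Homogeneity settles dependent vectors, which [add_coef] does not cover. *)
have col t u v : pm (f v) (t *: f u) ->
    pm (f ((t + 1) *: u)) (f u + f v) \/ pm (f ((1 - t) *: u)) (f u + f v).
  case=> ->; [left|right]; apply: pm_trans (f_scale _ _) _; left.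
    by rewrite scalerDl scale1r addrC.
  by rewrite scalerBl scale1r.
have [/lineP [t xE]|nx] := pselect (line y x).
  have := f_scale t y; rewrite -xE => /col; rewrite [f y + _]addrC.
  rewrite scalerDl scalerBl scale1r -xE => -[h|h]; [by left|right].
  by apply: pm_trans _ h; apply: f_pm; right; rewrite opprB.
have [/lineP [t yE]|ny] := pselect (line x y).
  have := f_scale t x; rewrite -yE => /col.
  by rewrite scalerDl scalerBl scale1r -yE [y + x]addrC.
have [z fz] := f_surj (f x + f y).
(* Off the plane, some [norm_dir u] vanishes on the plane but not at [z]; yet its transport vanishes
   at [f x] and [f y], hence at [f z]. *)
have [[b /lineP[a zE]]|nz] := pselect (plane x y z); last first.
  have sp : subspace (plane x y) by exact/subspace_add_line.
  have pp : proximinal (plane x y) by exact: proximinal_add_line.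
  have [u [su u0 uz]] := best_approx_norm_dir sp pp nz X_smooth.
  have f0 v : plane x y v -> norm_dir (f u) (f v) = 0.
    by move=> pv; apply: normr0_eq0; rewrite f_norm_dir// u0 ?normr0.
  case: uz; apply: normr0_eq0; rewrite -f_norm_dir// fz norm_dirD; last exact: f_smooth.
  rewrite !f0 ?addr0 ?normr0//; first exact/mem_add_line/(sline _).1.
  by apply/sub_add_line/mem_add_line.
have {}zE : z = a *: x + b *: y by rewrite -zE subrK.
have a1 := add_coef fz zE nx.
have b1 : `|b| = 1.
  by apply: (@add_coef y x z b a _ _ ny); rewrite addrC.
rewrite -fz.
have sgn1 (c : R) : `|c| = 1 -> c = 1 \/ c = -1.
  by case: (ger0P c) => _ h; [left|right]; lra.
have [aE|aE] := sgn1 _ a1; have [bE|bE] := sgn1 _ b1.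
- by left; apply: f_pm; left; rewrite zE aE bE !scale1r.
- by right; apply: f_pm; left; rewrite zE aE bE scaleN1r scale1r.
- by right; apply: f_pm; right; rewrite zE aE bE scaleN1r scale1r opprD opprK.
- by left; apply: f_pm; right; rewrite zE aE bE !scaleN1r opprD !opprK.
Qed.

(** A preimage of [- f y] is [y] up to sign, so [f_addE] also applies to [f x - f y]. If neither
    instance settles [f (x + y)], then [f x + f y] and [f x - f y] agree up to sign, so [f x] or
    [f y] is zero. *)
Let f_add x y : pm (f (x + y)) (f x + f y) \/ pm (f (x + y)) (f x - f y).
Proof.
have [|h1] := f_addE x y; first by left.
have fN v : pm (f (- v)) (f v) by apply: f_pm; right.
have [z fz] := f_surj (- f y).
have : pm z y by apply: f_inj; rewrite fz; right.
move=> zy.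
have h2 : pm (f (x + y)) (f x - f y) \/ pm (f (x - y)) (f x - f y).
  have := f_addE x z; rewrite fz; case: zy => ->; rewrite ?opprK; tauto.
case: h2 => [|h2]; first by right.
have := pm_trans (pm_sym h1) h2; case=> [/addrI/eqP|].
  rewrite -addr_eq0 => /eqP/(@double_eq0 R) fy0.
  have y0 : y = 0 by apply: normr0_eq0; rewrite -f_norm fy0 normr0.
  by left; move: h1; rewrite y0 subr0 addr0.
rewrite opprB [RHS]addrC => /addIr/eqP; rewrite -addr_eq0 => /eqP/(@double_eq0 R) fx0.
have -> : x = 0 by apply: normr0_eq0; rewrite -f_norm fx0 normr0.
left; rewrite add0r.
have -> : f 0 = 0 by apply: normr0_eq0; rewrite f_norm normr0.
by rewrite add0r; left.
Qed.

Theorem phase_isometry_smooth_convex : phase_equivalent_to_linear_isometry f.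
Proof.
(* The trivial space offers no nonzero reference vector. *)
have [[x0 x0P]|X0] := pselect (exists x : X, x <> 0); last first.
  have X00 (x : X) : x = 0 by apply: contrapT => x0; apply: X0; exists x.
  have f0 x : f x = 0 by apply: normr0_eq0; rewrite f_norm (X00 x) normr0.
  exists (fun=> 1); first by move=> _ [x _ <-]; right.
  split; first by move=> a u v; rewrite !f0 !scaler0 addr0.
  by move=> x y /=; rewrite !f0 (X00 x) (X00 y) !scaler0 !subrr !normr0.
pose g := phase_fix f_add x0.
have gD : forall x y, g (x + y) = g x + g y := phase_fixD f_scale f_inj f_add x0P.
have gZ : forall t x, g (t *: x) = t *: g x := phase_fixZ f_scale f_inj f_add x0P.
have g_pm : forall x, pm (g x) (f x) := phase_fix_pm f_add x0.
have gE x : (if g x == f x then 1 else -1) *: f x = g x.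
  case: eqVneq => [->|]; first by rewrite scale1r.
  by case: (g_pm x) => -> //; rewrite ?eqxx// scaleN1r.
exists (fun x => if g x == f x then 1 else -1).
  by move=> _ [x _ <-]; case: ifP => _; [right|left].
split=> [a u v|x y]; rewrite !gE; first by rewrite gD gZ.
rewrite -scaleN1r -gZ -gD scaleN1r.
by case: (g_pm (x - y)) => ->; rewrite ?normrN f_norm.
Qed.

End phase_isometry_theory.

(** * Convexity and smoothness of [|s|^p] for [p > 1] *)

Section power_convexity.
Context (R : realType) (p : R).
Hypothesis p1 : 1 < p.
Implicit Types (a b s t l : R).

Let p0 : 0 < p. Proof. exact: lt_trans p1. Qed.
Let p_neq0 : p != 0. Proof. by rewrite gt_eqF. Qed.
Let pB1_gt0 : 0 < p - 1. Proof. by rewrite subr_gt0. Qed.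

(* Convexity of [expR] between [0] and [p * ln t], whose combination with
   weights [1 - 1/p, 1/p] is [ln t]. *)
Lemma bernoulli_powR t : 0 <= t -> t != 1 -> 1 + p * (t - 1) < t `^ p.
Proof.
rewrite le_eqVlt => /predU1P[<- _|t0 t1]; first by rewrite powR0// sub0r mulrN1 subr_lt0.
pose L := ln t.
have L0 : L != 0 by rewrite ln_eq0.
have tE : t = expR L by rewrite lnK.
have -> : t `^ p = expR L * expR ((p - 1) * L).
  by rewrite -expRD /powR gt_eqF// -/L; congr expR; lra.
have h1 : 1 + (p - 1) * L < expR ((p - 1) * L).
  by apply: expR_gt1Dx; rewrite mulf_neq0// gt_eqF.
have h2 : 1 - L < expR (- L) by apply: expR_gt1Dx; rewrite oppr_eq0.
have eL : 0 < expR L := expR_gt0 L.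
have h3 : expR L * expR (- L) = 1 by rewrite -expRD subrr expR0.
have := ltr_pM2l eL (1 + (p - 1) * L) (expR ((p - 1) * L)); rewrite h1 => h4.
have := ltr_pM2l eL (1 - L) (expR (- L)); rewrite h2 h3 => h5.
rewrite tE; set E := expR L in h4 h5 *; set G := expR _ in h4 *.
(* This product is exactly the lower bound [E * (1 + (p - 1) * L)] from [h4] minus
   [1 + p * (E - 1)]. *)
have h6 : 0 < (p - 1) * (1 - E * (1 - L)) by rewrite mulr_gt0// subr_gt0.
by nra.
Qed.

Let tangent_nneg a b : 0 <= a -> 0 <= b -> b != a ->
  a `^ p + p * a `^ (p - 1) * (b - a) < b `^ p.
Proof.
rewrite le_eqVlt => /predU1P[<- b0 bn0|a0 b0 ba].
  rewrite powR0// powR0 ?gt_eqF// mulr0 mul0r addr0 powR_gt0//.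
  by rewrite lt_neqAle eq_sym bn0.
have ba1 : b / a != 1.
  by apply: contra ba => /eqP h; rewrite -[b](divfK (lt0r_neq0 a0)) h mul1r.
have := bernoulli_powR (divr_ge0 b0 (ltW a0)) ba1.
rewrite -(ltr_pM2l (powR_gt0 p a0)) -powRM//; last 2 first.
- exact: ltW.
- by rewrite divr_ge0// ltW.
rewrite [a * _]mulrC divfK ?gt_eqF//; apply: le_lt_trans.
rewrite -(mulr_powRB1 (ltW a0) p0) le_eqVlt; apply/orP; left; apply/eqP.
field; by rewrite gt_eqF.
Qed.

(** The derivative of [|s|^p], split into positive and negative parts so that its continuity needs
    only powers of [max s 0]. *)
Let dpow s := p * (Num.max s 0 `^ (p - 1) - Num.max (- s) 0 `^ (p - 1)).

Let dpow_ge0 a : 0 <= a -> dpow a = p * a `^ (p - 1).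
Proof.
move=> a0; rewrite /dpow max_l// max_r ?oppr_le0//.
by rewrite powR0 ?gt_eqF// subr0.
Qed.

Let dpowN a : dpow (- a) = - dpow a.
Proof. by rewrite /dpow opprK; lra. Qed.

Let tangent a b : b != a -> `|a| `^ p + dpow a * (b - a) < `|b| `^ p.
Proof.
wlog a0 : a b / 0 <= a.
  move=> h ba; have [|a0] := leP 0 a; first by move=> /h; apply.
  have := h (- a) (- b); rewrite oppr_ge0 eqr_opp !normrN dpowN => /(_ (ltW a0) ba).
  by apply: le_lt_trans; lra.
move=> ba; rewrite dpow_ge0// (ger0_norm a0).
have [b0|b0] := leP 0 b; first by rewrite ger0_norm//; exact: tangent_nneg.
rewrite ltr0_norm//.
(* For [b < 0] the slope at [a] is nonnegative, so the tangent at [b] is no higher than at [- b]. If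
   [- b = a], strictness comes from the positive slope. *)
have [ab|ab] := eqVneq (- b) a.
  have a_gt0 : 0 < a by lra.
  rewrite -ab gtrDl pmulr_rlt0; first lra.
  by rewrite mulr_gt0// powR_gt0//; lra.
apply: le_lt_trans _ (tangent_nneg a0 _ ab); last lra.
by rewrite lerD2l ler_wpM2l ?mulr_ge0 ?powR_ge0 ?(ltW p0)//; lra.
Qed.

Let tangent_le a b : `|a| `^ p + dpow a * (b - a) <= `|b| `^ p.
Proof.
have [->|/tangent/ltW//] := eqVneq b a.
by rewrite subrr mulr0 addr0.
Qed.

(** Weighting the tangent inequalities at the mixture [m] cancels their linear terms. *)
Lemma strict_convex_norm_powR a b l : 0 < l < 1 -> a != b ->
  `|l * a + (1 - l) * b| `^ p < l * `|a| `^ p + (1 - l) * `|b| `^ p.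
Proof.
move=> /andP[l0 l1] ab; set m := l * a + _.
have am : a != m.
  apply: contra ab => /eqP am; have : (1 - l) * (a - b) = 0 by rewrite /m in am; lra.
  by move/eqP; rewrite mulf_eq0 !subr_eq0 => /orP[|//]; lra.
have := tangent_le m b; have := tangent am.
set A := `|a| `^ p; set B := `|b| `^ p; set M := `|m| `^ p; set d := dpow m.
move=> h1 h2.
have h3 : l * (M + d * (a - m)) < l * A by rewrite ltr_pM2l.
have h4 : (1 - l) * (M + d * (b - m)) <= (1 - l) * B by apply: ler_wpM2l => //; lra.
suff : M = l * (M + d * (a - m)) + (1 - l) * (M + d * (b - m)) by lra.
by rewrite /m; ring.
Qed.

Lemma convex_norm_powR a b l : 0 <= l <= 1 ->
  `|l * a + (1 - l) * b| `^ p <= l * `|a| `^ p + (1 - l) * `|b| `^ p.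
Proof.
move=> /andP[l0 l1].
have [->|ab] := eqVneq a b.
  by rewrite -mulrDl addrCA subrr addr0 mul1r -mulrDl addrCA subrr addr0 mul1r.
move: l0 l1; rewrite le_eqVlt => /predU1P[<- _|l0].
  by rewrite subr0 !mul0r !add0r !mul1r.
rewrite le_eqVlt => /predU1P[->|l1].
  by rewrite subrr !mul0r !addr0 !mul1r.
by apply/ltW/strict_convex_norm_powR => //; rewrite l0.
Qed.

Lemma norm_powR_tangent_ge0 a b : 0 <= a -> 0 <= b ->
  a `^ p + p * a `^ (p - 1) * (b - a) <= b `^ p.
Proof.
move=> a0 b0; have [->|/tangent_nneg] := eqVneq b a.
  by rewrite subrr mulr0 addr0.
by move=> /(_ a0 b0)/ltW.
Qed.

(** Each one-sided bound on the power is pulled back to a bound on [t] by the inverse exponent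
    [r^-1]. *)
Let max_powR_continuous (r : R) : 0 < r ->
  continuous (fun s : R => Num.max s 0 `^ r).
Proof.
move=> r0 s; apply/cvgrPdist_lt => e e0.
have m0 (x : R) : 0 <= Num.max x 0 by rewrite le_max lexx orbT.
pose F (x : R) := Num.max x 0 `^ r; rewrite -/(F s).
have F0 x : 0 <= F x := powR_ge0 _ _.
have rV0 : 0 < r^-1 by rewrite invr_gt0.
have rK x : 0 <= x -> (x `^ r^-1) `^ r = x.
  by move=> x0; rewrite -powRrM mulVf ?gt_eqF// powRr1.
have rK' x : 0 <= x -> (x `^ r) `^ r^-1 = x.
  by move=> x0; rewrite -powRrM mulfV ?gt_eqF// powRr1.
have lt_pow (q x y : R) : 0 < q -> 0 <= x -> x < y -> x `^ q < y `^ q.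
  move=> q0 x0 xy; apply: gt0_ltr_powR => //; rewrite nnegrE//.
  exact: le_trans (ltW xy).
have sF : s <= F s `^ r^-1 by rewrite rK'// le_max lexx.
have up : \forall t \near s, F t < F s + e.
  have h : s < (F s + e) `^ r^-1.
    by apply: le_lt_trans sF _; apply: lt_pow; rewrite ?F0// ltrDl.
  near=> t; rewrite -[ltRHS]rK; last by rewrite addr_ge0// ltW.
  apply: lt_pow => //.
  rewrite gt_max; apply/andP; split; last by rewrite powR_gt0 ?ltr_wpDl.
  by near: t; exact: lt_nbhsl.
have lo : \forall t \near s, F s - e < F t.
  have [se|se] := ltP (F s - e) 0.
    by near=> t; apply: lt_le_trans se _.
  have h : (F s - e) `^ r^-1 < s.
    have : (F s - e) `^ r^-1 < Num.max s 0.
      by rewrite -[ltRHS]rK'//; apply: lt_pow => //; rewrite ltrBlDr ltrDl.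
    by rewrite lt_max => /orP[//|]; rewrite ltNge powR_ge0.
  near=> t; rewrite -[ltLHS]rK//.
  apply: lt_pow => //; first exact: powR_ge0.
  rewrite lt_max; apply/orP; left.
  by near: t; exact: lt_nbhsr.
near=> t; rewrite -/(F t) ltr_norml.
have h1 : F t < F s + e by near: t.
have h2 : F s - e < F t by near: t.
by lra.
Unshelve. all: by end_near. Qed.

Let dpow_continuous : continuous dpow.
Proof.
move=> s; have cm := max_powR_continuous pB1_gt0.
apply: cvgMr; apply: cvgB; first exact: cm.
apply: (@continuous_comp _ _ _ (fun x : R => - x)
  (fun x => Num.max x 0 `^ (p - 1)) s); last exact: cm.
by apply: cvgN; exact: cvg_id.
Qed.

(** The symmetric second difference of [|s|^p] divided by the step [1/(n+1)], not its square, so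
    first-order smoothness makes it vanish. *)
Definition second_diff a b (n : nat) : R :=
  n.+1%:R * (`|a + n.+1%:R^-1 * b| `^ p + `|a - n.+1%:R^-1 * b| `^ p
             - 2 * `|a| `^ p).

Lemma second_diff_ge0 a b n : 0 <= second_diff a b n.
Proof.
rewrite /second_diff mulr_ge0//.
have h c : `|a| `^ p + dpow a * c <= `|a + c| `^ p.
  by have := tangent_le a (a + c); rewrite [a + c]addrC addrK.
set y := _ * b; have := h y; have := h (- y); rewrite mulrN; lra.
Qed.

(** Convexity on the segments from [a] to [a + b] and [a - b]; the bound is free of [n], as
    dominated convergence requires. *)
Lemma second_diff_le a b n :
  second_diff a b n <= `|a + b| `^ p + `|a - b| `^ p - 2 * `|a| `^ p.
Proof.
rewrite /second_diff; set s := n.+1%:R^-1.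
have n0 : 0 < n.+1%:R :> R by rewrite ltr0n.
have s01 : 0 <= s <= 1 by rewrite invr_ge0 ltW//= invf_le1// ler1n.
have h (c : R) : `|a + s * c| `^ p <= s * `|a + c| `^ p + (1 - s) * `|a| `^ p.
  have -> : a + s * c = s * (a + c) + (1 - s) * a by ring.
  exact: convex_norm_powR.
rewrite -(ler_pM2l (_ : 0 < s)) ?invr_gt0// mulrA mulVf ?gt_eqF// mul1r.
by have := h b; have := h (- b); rewrite mulrN; lra.
Qed.

(** Tangents at the two shifted points, evaluated at [a], bound it by [b] times a difference of
    [dpow] values, and [dpow] is continuous. *)
Lemma second_diff_cvg0 a b : second_diff a b @ \oo --> (0 : R).
Proof.
have cs : (fun n => n.+1%:R^-1 : R) @ \oo --> (0 : R) by exact: cvg_harmonic.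
have dlim (c : R) : (fun n => dpow (a + n.+1%:R^-1 * c)) @ \oo --> dpow a.
  have lim : (fun n => a + n.+1%:R^-1 * c) @ \oo --> a.
    rewrite -[X in _ --> X]addr0; apply: cvgD; first exact: cvg_cst.
    by rewrite -[X in _ --> X](mul0r c); apply: cvgMl.
  exact: (cvg_comp _ dpow lim (@dpow_continuous a)).
have ub : (fun n => b * (dpow (a + n.+1%:R^-1 * b) - dpow (a + n.+1%:R^-1 * - b)))
    @ \oo --> (0 : R).
  rewrite -[X in _ --> X](mulr0 b) -(subrr (dpow a)).
  by apply: cvgMr; apply: cvgB; apply: dlim.
apply: (squeeze_cvgr _ (cvg_cst 0) ub).
near=> n; rewrite second_diff_ge0/= /second_diff; set s := n.+1%:R^-1.
have n0 : 0 < n.+1%:R :> R by rewrite ltr0n.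
rewrite -(ler_pM2l (_ : 0 < s)) ?invr_gt0// mulrA mulVf ?gt_eqF// mul1r.
have := tangent_le (a + s * b) a; have := tangent_le (a + s * - b) a.
rewrite mulrN; set d1 := dpow _; set d2 := dpow _; lra.
Unshelve. all: by end_near. Qed.

End power_convexity.

(** * Strict convexity and smoothness of [L^p] *)

Section Lspace_geometry.
Context (R : realType) (d : measure_display) (T : measurableType d).
Context (mu : {measure set T -> \bar R}) (p : R) (p1 : (1 <= p%:E)%E).
Hypothesis p_gt1 : 1 < p.

Local Notation Lp := (LspaceType mu p1).
Implicit Types u v w : Lp.

Let p0 : 0 < p. Proof. exact: lt_trans p_gt1. Qed.

Let pow u (t : T) : R := `|u t| `^ p.

Let pow_ge0 u t : 0 <= pow u t. Proof. exact: powR_ge0. Qed.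

Let measurable_pow u : measurable_fun setT (pow u).
Proof.
apply: (@measurableT_comp _ _ _ _ _ _ (@powR R ^~ p)); first exact: measurable_powR.
by apply: measurableT_comp => //; exact: Lspace_measurable.
Qed.

Let integral_pow u : (\int[mu]_t (pow u t)%:E = (`|u| `^ p)%:E)%E.
Proof.
by rewrite -poweR_EFin Lspace_normE powR_Lnorm ?gt_eqF.
Qed.

Let integrable_pow u : mu.-integrable setT (EFin \o pow u).
Proof.
apply/integrableP; split; first exact/measurable_EFinP.
under eq_integral do rewrite /= ger0_norm//.
by rewrite integral_pow ltry.
Qed.

Let integral_comb (a b c : R) u v w :
  mu.-integrable setT (fun t => (a * pow u t + b * pow v t + c * pow w t)%:E) /\
  (\int[mu]_t (a * pow u t + b * pow v t + c * pow w t)%:E =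
    (a * `|u| `^ p + b * `|v| `^ p + c * `|w| `^ p)%:E)%E.
Proof.
have iZ k x : mu.-integrable setT (fun t => (k%:E * (pow x t)%:E)%E).
  by apply: integrableZl => //; exact: integrable_pow.
have iD := integrableD measurableT (iZ a u) (iZ b v).
split; first by have := integrableD measurableT iD (iZ c w).
under eq_integral do rewrite !EFinD !EFinM.
rewrite integralD// integralD// !integralZl//; try exact: integrable_pow.
by rewrite !integral_pow.
Qed.

Lemma Lspace_combE (a b : R) u v :
  (a *: u + b *: v : Lp) = (fun t => a * u t + b * v t) %[ae mu].
Proof.
have := @Lspace_addE _ _ _ mu _ p1 (a *: u) (b *: v).
apply: filterS3 (@Lspace_scaleE _ _ _ mu _ p1 a u) (@Lspace_scaleE _ _ _ mu _ p1 b v).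
by move=> t /(_ I) eu /(_ I) ev /(_ I) euv _; rewrite euv eu ev.
Qed.

(** The pointwise convexity defect [k] is nonnegative with integral zero, so it vanishes almost
    everywhere; strict convexity of the power then forces [u = v]. *)
Let unit_eq u v l : 0 < l < 1 -> `|u| = 1 -> `|v| = 1 ->
  `|l *: u + (1 - l) *: v| = 1 -> u = v.
Proof.
move=> l01 u1 v1 w1; set w := l *: u + _ in w1.
pose k t := l * pow u t + (1 - l) * pow v t + (-1) * pow w t.
have [ik] := integral_comb l (1 - l) (-1) u v w.
rewrite u1 v1 w1 powR1 (_ : l * 1 + (1 - l) * 1 + -1 * 1 = 0); last by ring.
move=> k0.
have wE := Lspace_combE l (1 - l) u v.
have k_ge0 : \forall t \ae mu, 0 <= k t.
  apply: filterS wE => t /(_ I) wt; rewrite /k /(pow w) wt mulN1r subr_ge0.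
  by apply: convex_norm_powR => //; case/andP: l01 => /ltW -> /ltW ->.
have mk : measurable_fun setT (EFin \o k) by case/integrableP: ik.
have : (\int[mu]_t `|(k t)%:E| = 0)%E.
  rewrite -[RHS]k0; apply: ae_eq_integral => //; first exact: measurableT_comp.
  by apply: filterS k_ge0 => t kt _ /=; rewrite ger0_norm.
move/(ae_eq_integral_abs mu measurableT mk) => ka.
apply/Lspace_eqP; apply: filterS2 wE ka => t /(_ I) wt /(_ I)[kt] _.
apply/eqP; apply: contraPT kt => /eqP uv.
have := strict_convex_norm_powR p_gt1 l01 (introN eqP uv).
by rewrite /k /(pow w) wt => h; apply/eqP; rewrite gt_eqF// mulN1r subr_gt0.
Qed.

Lemma Lspace_strictly_convex : strictly_convex Lp.
Proof.
move=> u v uv.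
have [->|u0] := eqVneq u 0; first by rewrite normr0 scale0r scaler0.
have [->|v0] := eqVneq v 0; first by rewrite normr0 scale0r scaler0.
have nu : 0 < `|u| by rewrite normr_gt0.
have nv : 0 < `|v| by rewrite normr_gt0.
(* With this weight the mixture of the normalised vectors is [(u + v) / (|u| + |v|)], of norm 1 by
   hypothesis. *)
pose l := `|u| / (`|u| + `|v|).
have s0 : 0 < `|u| + `|v| by rewrite addr_gt0.
have l1 : 1 - l = `|v| / (`|u| + `|v|) by rewrite /l; field; rewrite gt_eqF.
have l01 : 0 < l < 1.
  by rewrite divr_gt0//= -subr_gt0 l1 divr_gt0.
have unit (x : Lp) : x != 0 -> `| `|x|^-1 *: x| = 1.
  by move=> x0; rewrite normrZ normfV normr_id mulVf// normr_eq0.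
have := @unit_eq (`|u|^-1 *: u) (`|v|^-1 *: v) l l01 (unit _ u0) (unit _ v0).
have -> : l *: (`|u|^-1 *: u) + (1 - l) *: (`|v|^-1 *: v) =
    (`|u| + `|v|)^-1 *: (u + v).
  rewrite l1 !scalerA scalerDr /l.
  by congr (_ *: _ + _ *: _); field; rewrite !gt_eqF.
rewrite normrZ uv gtr0_norm ?invr_gt0// mulVf ?gt_eqF// => /(_ erefl) e.
have vE : v = (`|v| / `|u|) *: u.
  by rewrite -scalerA e scalerA divff ?gt_eqF// scale1r.
by rewrite [in LHS]vE scalerA mulrC divfK// gt_eqF.
Qed.

(** Dominated convergence sends the integrated second differences to zero; the tangent to the power
    at [|u|] turns this into a bound on norms, with [t = n + 1]. *)
Lemma Lspace_smooth u : u <> 0 -> smooth_at u.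
Proof.
move=> /eqP u0 v e e0.
have nu : 0 < `|u| by rewrite normr_gt0.
pose w n : Lp := 1 *: u + n.+1%:R^-1 *: v.
pose w' n : Lp := 1 *: u + (- n.+1%:R^-1) *: v.
pose k n t := n.+1%:R * pow (w n) t + n.+1%:R * pow (w' n) t
  + (- (n.+1%:R * 2)) * pow u t.
(* The dominating function is the case [n = 0] of [k]. *)
pose g t := 1 * pow (w 0%N) t + 1 * pow (w' 0%N) t + (-2) * pow u t.
have comb n := integral_comb n.+1%:R n.+1%:R (- (n.+1%:R * 2)) (w n) (w' n) u.
have kE : {ae mu, forall t n, k n t = second_diff p (u t) (v t) n}.
  apply: ae_foralln => n.
  apply: filterS2 (Lspace_combE 1 n.+1%:R^-1 u v)
    (Lspace_combE 1 (- n.+1%:R^-1) u v) => t /(_ I) wt /(_ I) wt'.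
  rewrite /k /(pow (w n)) wt /(pow (w' n)) wt' /second_diff /pow !mul1r !mulNr.
  by ring.
have [ig _] := integral_comb 1 1 (-2) (w 0%N) (w' 0%N) u.
have gE : {ae mu, forall t, g t = `|u t + v t| `^ p + `|u t - v t| `^ p
    - 2 * `|u t| `^ p}.
  apply: filterS kE => t /(_ 0%N).
  by rewrite /k /second_diff /g invr1 !mul1r.
have mk n : measurable_fun setT (fun t => (k n t)%:E).
  by have [/integrableP[]] := comb n.
have cvg_k : {ae mu, forall t, setT t -> (fun n => (k n t)%:E) @ \oo --> (0 : \bar R)%E}.
  apply: filterS kE => t kt _; apply: cvg_EFin; first exact: nearW.
  apply: cvg_trans (second_diff_cvg0 p_gt1 (u t) (v t)).
  by apply: near_eq_cvg; apply: nearW => n /=; rewrite kt.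
have dom : {ae mu, forall t n, setT t -> (`|(k n t)%:E| <= (g t)%:E)%E}.
  apply: filterS2 kE gE => t kt gt n _.
  by rewrite kt gt /= lee_fin ger0_norm ?second_diff_ge0// second_diff_le.
have [_ _ lim] := @dominated_convergence _ _ _ mu setT measurableT
  (fun n t => (k n t)%:E) (cst 0%E) (fun t => (g t)%:E) mk
  (measurable_cst _) cvg_k ig dom.
pose K n : R := n.+1%:R * (`|w n| `^ p + `|w' n| `^ p - 2 * `|u| `^ p).
have limK : K @ \oo --> (0 : R).
  suff : (fun n => (K n)%:E) @ \oo --> (0%:E : \bar R) by move/fine_cvg.
  move: lim; rewrite integral0; apply: cvg_trans; apply: near_eq_cvg.
  apply: nearW => n; rewrite /= (comb n).2; congr EFin; rewrite /K; ring.
(* The slope of the power at [|u|], positive because [u] is nonzero. *)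
pose c := p * `|u| `^ (p - 1).
have c0 : 0 < c by rewrite mulr_gt0// powR_gt0.
have [n Kn] : exists n, K n < c * e.
  have /cvgrPdist_lt/(_ (c * e)) := limK; rewrite mulr_gt0// => /(_ isT)[n _ /(_ n)].
  by rewrite /= leqnn sub0r normrN => /(_ isT)/(le_lt_trans (ler_norm _)); exists n.
exists n.+1%:R; first by rewrite ltr0n.
have n0 : 0 < n.+1%:R :> R by rewrite ltr0n.
have -> : n.+1%:R *: u + v = n.+1%:R *: w n.
  by rewrite scalerDr scale1r scalerA divff ?gt_eqF// scale1r.
have -> : n.+1%:R *: u - v = n.+1%:R *: w' n.
  by rewrite scalerDr scale1r scalerA mulrN divff ?gt_eqF// scaleN1r.
rewrite !normrZ !gtr0_norm//.
have := norm_powR_tangent_ge0 p_gt1 (ltW nu) (normr_ge0 (w n)).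
have := norm_powR_tangent_ge0 p_gt1 (ltW nu) (normr_ge0 (w' n)).
rewrite -/c => h' h.
rewrite -ltrBlDl -(ltr_pM2l c0); apply: le_lt_trans Kn; rewrite /K.
have -> : c * (n.+1%:R * `|w n| + n.+1%:R * `|w' n| - 2 * (n.+1%:R * `|u|)) =
  n.+1%:R * (c * (`|w n| - `|u|) + c * (`|w' n| - `|u|)) by ring.
by rewrite ler_pM2l//; lra.
Qed.

End Lspace_geometry.

Theorem corollary2p9 (R : realType) (d : measure_display) (T : measurableType d)
    (mu : {measure set T -> \bar R}) (p : R) (p_gt1 : (1 < p%:E)%E)
    (Y : normedModType R) (f : LspaceType mu (ltW p_gt1) -> Y) :
  set_surj [set: LspaceType mu (ltW p_gt1)] [set: Y] f ->
  phase_isometry f ->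
  phase_equivalent_to_linear_isometry f.
Proof.
move=> f_surj f_phase.
have p1 : 1 < p by rewrite -lte_fin.
apply: phase_isometry_smooth_convex f_phase _ _.
- by move=> y; have [x _ <-] := f_surj y I; exists x.
- exact: Lspace_strictly_convex.
- exact: Lspace_smooth.
Qed.
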